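(* Let $d\ge 1$, let $\mathbb{F}_d$ be the free group on generators $\{a_1,\dots,a_d\}$, let $\Sigma\subseteq\{a_1^{\pm1},\dots,a_d^{\pm1}\}$, and let $S=\langle\Sigma\rangle^+$ be the submonoid of $\mathbb{F}_d$ generated by $\Sigma$, with inclusion $\iota\colon S\to\mathbb{F}_d$. Then $S$ has the PA property. Moreover, if $\mathbf{F}_d=(\mathbb{F}_d,\iota)$ is the free $S$-group (that is, if $\Sigma$ contains at least one of $a_i,a_i^{-1}$ for each $i$), then $\operatorname{Ext}_{\mathbf{F}_d}(\mathcal{A}^S,S)=\mathcal{M}_S(\mathcal{A}^S)$ for every finite alphabet $\mathcal{A}$.
   Context: $\langle\Sigma\rangle^+$ is the set of all finite products of elements of $\Sigma$, including the empty product (the identity $\varepsilon$). An $S$-group is a pair $(G,\eta)$ with $G$ a group and $\eta\colon S\to G$ a semigroup morphism whose image generates $G$ as a group; it is the free $S$-group if for every $S$-group $(G',\eta')$ there is a unique group morphism $\theta\colon G\to G'$ with $\theta\circ\eta=\eta'$. For a finite set $\mathcal{A}$ (alphabet, discrete), $\mathcal{A}^S$ has the product topology and shift action $(s\cdot x)(t)=x(ts)$; similarly $\mathbb{F}_d$ acts on $\mathcal{A}^{\mathbb{F}_d}$. For a semigroup $T$ acting continuously on a compact metric space $X$, $\mathcal{M}_T(X)$ is the set of $T$-invariant Borel probability measures ($\mu(t^{-1}A)=\mu(A)$ for all $t\in T$ and Borel $A$, where $t^{-1}A=\{x:t\cdot x\in A\}$), with the weak-* topology, and $\mathcal{P}(X,T)$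 is the set of elements of $\mathcal{M}_T(X)$ with finite support. $S$ has the PA property if $\mathcal{P}(\mathcal{A}^S,S)$ is weak-* dense in $\mathcal{M}_S(\mathcal{A}^S)$ for every finite alphabet $\mathcal{A}$. $\operatorname{Ext}_{\mathbf{F}_d}(\mathcal{A}^S,S)$ is the set of $\mu\in\mathcal{M}_S(\mathcal{A}^S)$ for which there is $\bar\mu\in\mathcal{M}_{\mathbb{F}_d}(\mathcal{A}^{\mathbb{F}_d})$ with $\pi_*\bar\mu=\mu$, where $\pi\colon\mathcal{A}^{\mathbb{F}_d}\to\mathcal{A}^S$, $\pi(x)=x\circ\iota=x|_S$. (The natural $\mathbf{F}_d$-extension of $\mathcal{A}^S$ is identified with $\mathcal{A}^{\mathbb{F}_d}$ equipped with this map.) *)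

(* Defs.v *)
From HB Require Import structures.
From mathcomp Require Import all_boot all_order all_algebra.
From mathcomp Require Import all_classical all_reals all_analysis.

Set Implicit Arguments.
Unset Strict Implicit.
Unset Printing Implicit Defensive.

Import Order.TTheory GRing.Theory Num.Theory.
Import numFieldNormedType.Exports.

Local Open Scope classical_set_scope.
Local Open Scope group_scope.

(* The letter (i, true) stands for the generator a_i, and (i, false) for its
   inverse. *)
Notation letter d := ('I_d * bool)%type.

Definition linv d (x : letter d) : letter d := (x.1, ~~ x.2).

Definition reduced d (w : seq (letter d)) : bool :=
  sorted (fun x y => y != linv x) w.

Record free_group (d : nat) := FreeGroup {
  word :> seq (letter d);
  word_reduced : reduced word }.

HB.instance Definition _ d := [isSub for @word d].
HB.instance Definition _ d := [Choice of free_group d by <:].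

Section FreeGroup.
Variable d : nat.
Implicit Types (x : letter d) (u v w : seq (letter d)).

(* The reduced form of x :: w, when w is reduced. *)
Definition push x w : seq (letter d) :=
  if w is y :: w' then if y == linv x then w' else x :: w else [:: x].

Definition winv w : seq (letter d) := rev (map (@linv d) w).

Lemma linvK : involutive (@linv d).
Proof. by case=> i b; rewrite /linv /= negbK. Qed.

Lemma reduced_push x w : reduced w -> reduced (push x w).
Proof.
case: w => [|y w] //= yw; case: eqP => [_|/eqP ne]; first exact: path_sorted yw.
by rewrite /= ne.
Qed.

Lemma reduced_pushes u w : reduced w -> reduced (foldr push w u).
Proof. by move=> rw; elim: u => //= x u; apply: reduced_push. Qed.

Lemma pushK x w : reduced w -> push (linv x) (push x w) = w.
Proof.
case: w => [|y w] /=; first by rewrite linvK eqxx.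
case: eqP => [-> | _ _] /=; last by rewrite linvK eqxx.
by case: w => [|z w] //= /andP[/negPf-> _].
Qed.

Lemma pushKV x w : reduced w -> push x (push (linv x) w) = w.
Proof. by move=> rw; rewrite -{1}[x]linvK pushK. Qed.

Lemma foldr_push x u w : reduced w ->
  foldr push w (push x u) = push x (foldr push w u).
Proof.
case: u => [|y u] //= rw; case: eqP => [->|_] //=.
by rewrite pushKV // reduced_pushes.
Qed.

Lemma foldr_pushA u v w : reduced w ->
  foldr push (foldr push w v) u = foldr push w (foldr push v u).
Proof. by move=> rw; elim: u => //= x u ->; rewrite foldr_push. Qed.

Lemma foldr_push_reduced w : reduced w -> foldr push [::] w = w.
Proof.
elim: w => //= x w IH xw; rewrite (IH (path_sorted xw)).
by case: w xw {IH} => //= y w /andP[/negPf->].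
Qed.

Lemma reduced_winv w : reduced w -> reduced (winv w).
Proof.
rewrite /reduced rev_sorted sorted_map; apply: sub_sorted => x y /=.
by apply: contra => /eqP/(can_inj (@linvK))->; rewrite linvK.
Qed.

Lemma foldr_push_winvl u w : reduced w ->
  foldr push (foldr push w u) (winv u) = w.
Proof.
move=> rw; elim: u w rw => //= x u IH w rw; rewrite /winv map_cons rev_cons.
by rewrite foldr_rcons pushK ?IH // reduced_pushes.
Qed.

Lemma winvK : involutive winv.
Proof. by move=> w; rewrite /winv map_rev revK mapK //; exact: linvK. Qed.

Definition fg_one := FreeGroup (isT : @reduced d [::]).
Definition fg_mul (g h : free_group d) :=
  FreeGroup (reduced_pushes g (word_reduced h)).
Definition fg_inv (g : free_group d) := FreeGroup (reduced_winv (word_reduced g)).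

Lemma fg_mulA : associative fg_mul.
Proof. by move=> f g h; apply: val_inj; rewrite /= foldr_pushA // word_reduced. Qed.

Lemma fg_mul1 : left_id fg_one fg_mul.
Proof. by move=> g; apply: val_inj. Qed.

Lemma fg_mulr1 : right_id fg_one fg_mul.
Proof. by move=> g; apply: val_inj; rewrite /= foldr_push_reduced // word_reduced. Qed.

Lemma fg_mulV : left_inverse fg_one fg_inv fg_mul.
Proof.
move=> g; apply: val_inj => /=.
have /(_ (word g)) := @foldr_push_winvl _ [::] isT.
by rewrite foldr_push_reduced // word_reduced.
Qed.

Lemma fg_mulrV : right_inverse fg_one fg_inv fg_mul.
Proof.
move=> g; apply: val_inj => /=; rewrite -[X in foldr _ _ X]winvK.
have /(_ (winv (word g))) := @foldr_push_winvl _ [::] isT.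
by rewrite foldr_push_reduced // reduced_winv // word_reduced.
Qed.

HB.instance Definition _ :=
  isGroup.Build (free_group d) fg_mulA fg_mul1 fg_mulr1 fg_mulV fg_mulrV.

Definition fgen (i : 'I_d) : free_group d :=
  FreeGroup (isT : reduced [:: (i, true)]).

End FreeGroup.

Definition products (G : monoidType) (X : set G) : set G :=
  [set g | exists2 w : seq G, (forall x, x \in w -> X x) & g = \prod_(x <- w) x].

Definition submonoid (G : monoidType) (X : set G) : Type := set_type (products X).

Section Submonoid.
Variables (G : monoidType) (X : set G).

Lemma products_monoid_closed : monoid_closed (mem (products X)).
Proof.
split; first by rewrite inE; exists [::] => //; rewrite big_nil.
move=> g h; rewrite !inE => -[u uX ->] [v vX ->].
exists (u ++ v); last by rewrite big_cat.
by move=> x; rewrite mem_cat => /orP[/uX|/vX].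
Qed.

HB.instance Definition _ := SubChoice.on (submonoid X).
HB.instance Definition _ := SubChoice_isSubMonoid.Build G _ (submonoid X)
  products_monoid_closed.

Definition submonoid_incl (s : submonoid X) : G := \val s.

End Submonoid.
Arguments submonoid_incl {G} X s.

Definition is_Sgroup (S : semigroupType) (G : groupType) (eta : S -> G) : Prop :=
  {morph eta : s t / s * t} /\
  (forall H : {pred G}, group_closed H -> (forall s, eta s \in H) ->
     forall g, g \in H).

Definition is_free_Sgroup (S : semigroupType) (G : groupType) (eta : S -> G) :
    Prop :=
  is_Sgroup eta /\
  forall (G' : groupType) (eta' : S -> G'), is_Sgroup eta' ->
    exists! theta : G -> G',
      {morph theta : g h / g * h} /\ theta \o eta = eta'.

Definition borel (X : ptopologicalType) : Type := g_sigma_algebraType (@open X).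
HB.instance Definition _ (X : ptopologicalType) :=
  Measurable.copy (borel X) (g_sigma_algebraType (@open X)).

(* Borel probability measures on X with the weak-* topology, i.e. the coarsest
   one making mu |-> \int f dmu continuous for every continuous f : X -> R.
   X is meant to be compact, so that every such f is bounded. *)
Definition prob (R : realType) (X : ptopologicalType) : Type :=
  probability (borel X) R.
HB.instance Definition _ R X := Choice.copy (prob R X) (probability (borel X) R).

Definition integrals (R : realType) (X : ptopologicalType) (mu : prob R X) :
    {ptws continuousType X R -> R} :=
  fun f => (\int[mu]_x f x)%R.

HB.instance Definition _ R X :=
  Topological.copy (prob R X) (initial_topology (@integrals R X)).

Definition invariant_measures (R : realType) (T : Type) (X : ptopologicalType)
    (act : T -> X -> X) : set (prob R X) :=
  [set mu | forall (t : T) (B : set (borel X)), measurable B ->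
     mu (act t @^-1` B) = mu B].
Arguments invariant_measures R {T X} act.

Definition support (R : realType) (X : ptopologicalType) (mu : prob R X) : set X :=
  [set x | forall U : set X, open U -> U x -> (0 < mu U)%E].

Definition periodic_measures (R : realType) (T : Type) (X : ptopologicalType)
    (act : T -> X -> X) : set (prob R X) :=
  invariant_measures R act `&` [set mu | finite_set (support mu)].
Arguments periodic_measures R {T X} act.

(* Alphabets are nonempty finite types: measurable spaces are pointed in the
   library. The base point plays no role, and over the empty alphabet there is
   no probability measure at all. *)
#[short(type="alphabetType")]
HB.structure Definition Alphabet := {A of Finite A & isPointed A}.

Definition fullshift (T : Type) (A : alphabetType) : Type :=
  {ptws T -> discrete_topology A}.
HB.instance Definition _ T A := Topological.copy (fullshift T A)
  {ptws T -> discrete_topology A}.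
HB.instance Definition _ T A := isPointed.Build (fullshift T A) (fun=> point).

Definition shift_act (T : semigroupType) (A : alphabetType) (s : T)
    (x : fullshift T A) : fullshift T A :=
  fun t => x (t * s).
Arguments shift_act T A s x : clear implicits.

Definition has_PA (R : realType) (S : semigroupType) : Prop :=
  forall A : alphabetType,
    invariant_measures R (shift_act S A) `<=`
    closure (periodic_measures R (shift_act S A)).

(* The natural extension of A^S to an S-group (G, eta) is A^G, mapped to A^S by
   precomposition with eta. *)
Definition restrict_along (S G : Type) (eta : S -> G) (A : alphabetType)
    (x : fullshift G A) : fullshift S A :=
  x \o eta.
Arguments restrict_along {S G} eta A x.

Definition ext_measures (R : realType) (S : semigroupType) (G : groupType)
    (eta : S -> G) (A : alphabetType) : set (prob R (fullshift S A)) :=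
  [set mu | invariant_measures R (shift_act S A) mu /\
    exists2 nu : prob R (fullshift G A),
      invariant_measures R (shift_act G A) nu &
      forall B : set (borel (fullshift S A)), measurable B ->
        pushforward nu
          (restrict_along eta A : borel _ -> borel (fullshift S A)) B =
        mu B].
Arguments ext_measures R {S G} eta A.

(* Main.v *)
Require Import Defs.
From HB Require Import structures.
From mathcomp Require Import all_boot all_order all_algebra all_fingroup finmap.
From mathcomp Require Import all_classical all_reals all_analysis.
From mathcomp Require Import measurable_realfun ring lra.

(** The theorem rests on one construction, [finite_models]: an S-invariant
    measure [mu] on A^S is approximated, on the patterns seen through the ball
    of radius n, by the uniform distribution on a finite set of configurations
    of A^F, restricted to S, that the whole free group F permutes.

    To find it, let P be the finite set of A-patterns on the ball of radius n
    of S. For a generator x in Sigma, the pair (pattern of z, pattern of x.z)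
    has, when z is drawn from [mu], two equal marginals, because [mu] is
    invariant. So label N vertices by patterns, with frequencies those of
    [mu] up to rounding; the rounded law of the pairs says how many vertices
    labelled p are to be sent by x to vertices labelled q, and the equality of
    the marginals makes these demands satisfiable by a permutation of the
    vertices ([rounded_matching]). Rounding spoils only a bounded number of
    vertices, the bound being independent of N. Freeness enters here: the
    permutations attached to the generators of F can be chosen one at a time,
    and any choice is an action of F. A vertex u then yields the configuration
    g |-> (label of g.u, read at the identity); unless the walk from u along
    some word of length at most n meets a spoiled vertex, which happens to a
    bounded number of vertices, the restriction of that configuration to the
    ball is exactly the label of u ([restrict_good]).

    Density of periodic measures follows, because convergence on the sets that
    depend on finitely many coordinates is weak-* convergence ([cvg_prob], by
    uniform continuity on the compact space A^S).

    For the extension to F, the same finite models, seen in A^F, have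
    frequencies whose limit along an ultrafilter is a finitely additive
    probability on all subsets of A^F that is F-invariant and projects to [mu]
    ([invariant_mean]). On clopen subsets of a compact space, finite
    additivity is countable additivity, so Caratheodory extension turns this
    limit into a Borel measure ([clopen_content_extension]).

    The characterization of the free S-groups is the universal property of F:
    a semigroup morphism defined on S prescribes the image of each generator
    of F, through the generator or through its inverse. Conversely, if Sigma
    misses both a_i and its inverse, then S lies in a proper subgroup of F. *)

Set Implicit Arguments.
Unset Strict Implicit.
Unset Printing Implicit Defensive.

Import Order.TTheory GRing.Theory Num.Theory.
Import numFieldNormedType.Exports.

(** * Finite vertex sets with prescribed transitions *)

Lemma count_mem_complete (T : eqType) (s t : seq T) :
  (forall x, count_mem x s <= count_mem x t) -> exists r, perm_eq (s ++ r) t.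
Proof.
move=> /count_subseqP[s' ss' sE]; have [r tE] := perm_to_subseq ss'.
by exists r; rewrite perm_sym (permPl tE) perm_cat2r perm_sym.
Qed.

(** Pad the list of prescribed transitions to a list [L] of N pairs whose two
    projections are both rearrangements of the labels. If [p] and [q] are the
    rearrangements, sending [p i] to [q i] realizes the i-th pair of [L]; only
    the pairs added by the padding can violate [e]. *)
Lemma labelled_matching (T : eqType) N (C : N.-tuple T) (E : seq (T * T))
    (e : rel T) :
  (forall x, count_mem x (unzip1 E) <= count_mem x C) ->
  (forall x, count_mem x (unzip2 E) <= count_mem x C) ->
  all (fun pq => e pq.1 pq.2) E ->
  exists s : 'S_N,
    #|[pred v | ~~ e (tnth C v) (tnth C (s v))]| <= N - size E.
Proof.
move=> /count_mem_complete[r1 E1] /count_mem_complete[r2 E2] Ee.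
have szE s r : perm_eq (s ++ r) C -> size s + size r = N.
  by move=> /perm_size; rewrite size_cat size_tuple.
have sz1 := szE _ _ E1; have sz2 := szE _ _ E2; rewrite !size_map in sz1 sz2.
have r12 : size r1 = size r2 by apply/eqP; rewrite -(eqn_add2l (size E)) sz1 sz2.
pose L := E ++ zip r1 r2.
have [p pE] : exists p : 'S_N, unzip1 L = [seq tnth C (p i) | i <- enum 'I_N].
  suff /tuple_permP[p ->] : perm_eq (unzip1 L) C by exists p.
  by rewrite /L /unzip1 map_cat -/(unzip1 (zip _ _)) unzip1_zip ?r12.
have [q qE] : exists q : 'S_N, unzip2 L = [seq tnth C (q i) | i <- enum 'I_N].
  suff /tuple_permP[q ->] : perm_eq (unzip2 L) C by exists q.
  by rewrite /L /unzip2 map_cat -/(unzip2 (zip _ _)) unzip2_zip ?r12.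
exists (p^-1 * q)%g.
have -> : #|[pred v | ~~ e (tnth C v) (tnth C ((p^-1 * q)%g v))]| =
          count (fun i => ~~ e (tnth C (p i)) (tnth C (q i))) (enum 'I_N).
  rewrite -sum1_card (reindex_inj (@perm_inj _ p)) -sum1_count big_enum_cond /=.
  by apply: eq_bigl => i; rewrite inE permM permK.
have LE : L = [seq (tnth C (p i), tnth C (q i)) | i <- enum 'I_N].
  by rewrite -[L]zip_unzip pE qE zip_map.
have -> : count (fun i => ~~ e (tnth C (p i)) (tnth C (q i))) (enum 'I_N) =
          count (fun pq => ~~ e pq.1 pq.2) L by rewrite LE count_map.
rewrite /L count_cat; have -> : count (fun pq => ~~ e pq.1 pq.2) E = 0.
  apply/eqP; rewrite -leqn0 leqNgt -has_count -all_predC.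
  by apply: sub_all Ee => pq /= ->.
rewrite add0n (leq_trans (count_size _ _))//.
by rewrite size_zip r12 minnn -sz2 addKn.
Qed.

Definition tally_list (Q : finType) (h : Q -> nat) : seq Q :=
  flatten [seq nseq (h q) q | q <- enum Q].

Lemma count_tally_list (Q : finType) (h : Q -> nat) (P : pred Q) :
  count P (tally_list h) = \sum_(q | P q) h q.
Proof.
rewrite /tally_list count_flatten -map_comp sumnE big_map big_enum /=.
rewrite [RHS]big_mkcond; apply: eq_bigr => q _; rewrite count_nseq.
by case: (P q); rewrite ?mul1n.
Qed.

Lemma size_tally_list (Q : finType) (h : Q -> nat) :
  size (tally_list h) = \sum_q h q.
Proof. by rewrite -count_predT count_tally_list. Qed.

Section Rounding.
Variables (R : realType) (N : nat).
Local Open Scope ring_scope.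

Definition rounded (Q : finType) (w : Q -> R) (q : Q) : nat :=
  Num.truncn (N%:R * w q).

Section Bounds.
Variables (Q : finType) (w : Q -> R).
Hypothesis w_ge0 : forall q, 0 <= w q.

Lemma rounded_le (P : pred Q) :
  (\sum_(q | P q) rounded w q)%N%:R <= N%:R * \sum_(q | P q) w q.
Proof.
rewrite natr_sum mulr_sumr; apply: ler_sum => q _.
by rewrite truncn_le mulr_ge0.
Qed.

Lemma rounded_ge (P : pred Q) :
  N%:R * \sum_(q | P q) w q <= (\sum_(q | P q) rounded w q)%N%:R + #|Q|%:R.
Proof.
have Q1 : #|Q|%:R = \sum_(q : Q) 1 :> R by rewrite sumr_const.
rewrite natr_sum mulr_sumr.
apply: (@le_trans _ _ (\sum_(q | P q) ((rounded w q)%:R + 1))).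
  by apply: ler_sum => q _; rewrite natr1 ltW// truncnS_gt.
rewrite big_split lerD// Q1 [X in _ <= X](bigID P) /= lerDl.
by rewrite sumr_ge0.
Qed.
End Bounds.

Lemma rounded_labels (Q : finType) (v : Q -> R) : (forall q, 0 <= v q) ->
  \sum_q v q = 1 ->
  exists C : N.-tuple Q, (forall q, rounded v q <= count_mem q C)%N /\
    forall P : pred Q,
      `|(count P C)%:R - N%:R * \sum_(q | P q) v q| <= #|Q|%:R.
Proof.
move=> v0 v1.
have [q0 _|Q0] := pickP (fun _ : Q => true); last first.
  by move: v1; rewrite big_pred0// => /eqP; rewrite eq_sym oner_eq0.
have leN : (\sum_q rounded v q <= N)%N.
  by have := rounded_le v0 predT; rewrite v1 mulr1 ler_nat.
(* Rounding down leaves some entries free; any label can fill them. *)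
pose r := (N - \sum_q rounded v q)%N.
have szC : size (tally_list (rounded v) ++ nseq r q0) == N.
  by rewrite size_cat size_nseq size_tally_list subnKC.
exists (Tuple szC); split => [q|P] /=.
  by rewrite count_cat count_tally_list big_pred1_eq leq_addr.
have rQ : r%:R <= #|Q|%:R :> R.
  rewrite /r natrB// lerBlDl; have := rounded_ge v predT.
  by rewrite v1 mulr1.
rewrite count_cat count_tally_list count_nseq natrD natrM.
have := rounded_le v0 P; have := rounded_ge v P.
have : 0 <= r%:R :> R by [].
case: (P q0) => /=; rewrite ?mul0r ?mul1r ?addr0 => ? ? ?; rewrite ler_norml; lra.
Qed.

(** The rounded pairs with first entry [p] number at most N v(p), hence, being
    an integer, at most the rounding of N v(p): this is why rounding down
    keeps the demands of [labelled_matching] satisfiable, and why it costs at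
    most one vertex per pair of labels, whatever N is. *)
Lemma rounded_matching (Q : finType) (v : Q -> R) (w : Q * Q -> R)
    (C : N.-tuple Q) (e : rel Q) :
  (forall p, 0 <= w p) ->
  (forall p, \sum_q w (p, q) = v p) -> (forall q, \sum_p w (p, q) = v q) ->
  \sum_q v q = 1 ->
  (forall q, rounded v q <= count_mem q C)%N ->
  (forall p, 0 < w p -> e p.1 p.2) ->
  exists s : 'S_N,
    (#|[pred u | ~~ e (tnth C u) (tnth C (s u))]| <= #|{: Q * Q}|)%N.
Proof.
move=> w0 w1 w2 v1 vC we; pose E := tally_list (rounded w).
have le_marginal (P : pred (Q * Q)) q : \sum_(x | P x) w x = v q ->
    (count P E <= count_mem q C)%N.
  move=> wv; apply: leq_trans (vC q).
  rewrite /E count_tally_list truncn_ge_nat; first by rewrite -wv rounded_le.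
  by rewrite mulr_ge0// -wv sumr_ge0.
have [|||s sP] := @labelled_matching _ _ C E e.
- move=> q; rewrite count_map; apply: le_marginal.
  transitivity (\sum_(p | p == q) \sum_q' w (p, q')).
    by rewrite pair_big_dep; apply: eq_big => [[p q']|[p q'] _] //=; rewrite andbT.
  by rewrite big_pred1_eq.
- move=> q; rewrite count_map; apply: le_marginal.
  transitivity (\sum_(q' | q' == q) \sum_p w (p, q')).
    by rewrite exchange_big pair_big_dep; apply: eq_big => [[p q']|[p q'] _] //=.
  by rewrite big_pred1_eq.
- apply/allP => p; rewrite -has_pred1 has_count /E count_tally_list big_pred1_eq.
  rewrite truncn_gt0 => Nw; apply: we; rewrite lt_neqAle w0 andbT.
  by apply: contraTneq Nw => <-; rewrite mulr0 ler10.
exists s; apply: leq_trans sP _; rewrite leq_subLR -(ler_nat R) natrD.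
rewrite size_tally_list; have := rounded_ge w predT.
have -> : \sum_p w p = 1.
  by rewrite -v1 -(eq_bigr _ (fun p _ => w1 p)) pair_bigA; apply: eq_bigr => -[].
by rewrite mulr1.
Qed.
End Rounding.

Section GoodVertices.
Variables (V J : finType) (s : J -> V -> V) (bad : J -> pred V) (K : nat).
Hypothesis s_inj : forall j, injective (s j).
Hypothesis badK : forall j, #|bad j| <= K.

(** Defined by following the walks that start at [v], so that the exceptions
    can be counted one step at a time. *)
Fixpoint good n v := if n is n'.+1
  then [forall j, ~~ bad j v && good n' (s j v)] else true.

Fixpoint good_bound n := if n is n'.+1 then #|J| * (K + good_bound n') else 0.

(** A walk of length at most [n.+1] that uses a bad step either starts with
    one or continues from a vertex that is not good for [n]; the latter are as
    many as their preimages under the injection [s j]. *)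
Lemma card_not_good n : #|[pred v | ~~ good n v]| <= good_bound n.
Proof.
elim: n => [|n IH] /=; first by rewrite leqn0; apply/eqP/eq_card0 => v.
have cardE (P : pred V) : #|P| = \sum_v P v.
  rewrite -sum1_card big_mkcond; apply: eq_bigr => v _.
  by rewrite unfold_in; case: (P v).
rewrite cardE; apply: (@leq_trans (\sum_v \sum_j (bad j v + ~~ good n (s j v)))).
  apply: leq_sum => v _ /=; case: forallP => //= /forallP.
  rewrite negb_forall => /existsP[j jP]; rewrite (bigD1 j)//=.
  by rewrite (leq_trans _ (leq_addr _ _))//; case: (bad j v) jP; case: (good _ _).
rewrite exchange_big -sum_nat_const; apply: leq_sum => j _; rewrite big_split.
rewrite leq_add//; first by rewrite -cardE.
by apply: leq_trans IH; rewrite cardE [X in _ <= X](reindex_inj (@s_inj j)).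
Qed.
End GoodVertices.

Local Open Scope classical_set_scope.
Local Open Scope group_scope.

(** * Reduced words and actions of the free group *)

Definition lgen d (x : letter d) : free_group d :=
  FreeGroup (isT : reduced [:: x]).

Section Words.
Variable d : nat.
Implicit Types (x : letter d) (g h : free_group d) (w : seq (letter d)).

Lemma word_inj : injective (@word d).
Proof. exact: val_inj. Qed.

Lemma word_mul g h : word (g * h) = foldr (@push d) (word h) (word g).
Proof. by []. Qed.

Lemma lgen_true (i : 'I_d) : lgen (i, true) = fgen i.
Proof. exact: val_inj. Qed.

Lemma lgen_false (i : 'I_d) : lgen (i, false) = (fgen i)^-1.
Proof. exact: val_inj. Qed.

Lemma lgen_linv x : lgen (linv x) = (lgen x)^-1.
Proof. exact: val_inj. Qed.

Lemma word_prod w (rw : reduced w) : FreeGroup rw = \prod_(x <- w) lgen x.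
Proof.
apply: word_inj => /=; elim: w rw => [|x w IH] rw; first by rewrite big_nil.
rewrite big_cons word_mul /= -(IH (path_sorted rw)).
by case: w rw {IH} => //= y w /andP[/negPf->].
Qed.

Lemma free_group_prod g : g = \prod_(x <- word g) lgen x.
Proof. by case: g => w rw; rewrite -word_prod. Qed.

Section WordAction.
Variables (X : Type) (f : letter d -> X -> X).
Hypothesis fK : forall x, cancel (f x) (f (linv x)).

Definition word_act g (v : X) : X := foldr f v (word g).

Let foldr_act_push x w v : foldr f v (push x w) = f x (foldr f v w).
Proof.
case: w => //= y w; case: eqP => [->|//].
by have := fK (linv x); rewrite linvK => ->.
Qed.

(** The freeness of the free group, in the form used twice below: on the
    finite models, and on a target group acting on itself by translation. *)
Lemma word_actM g h v : word_act (g * h) v = word_act g (word_act h v).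
Proof.
rewrite /word_act word_mul; elim: (word g) => //= x w IH.
by rewrite foldr_act_push IH.
Qed.

Lemma word_actK g : cancel (word_act g) (word_act g^-1).
Proof. by move=> v; rewrite -word_actM mulVg. Qed.
End WordAction.

Lemma morph_letters (H : groupType) (f f' : free_group d -> H) :
  {morph f : g h / g * h} -> {morph f' : g h / g * h} ->
  (forall x, f (lgen x) = f' (lgen x)) -> f = f'.
Proof.
move=> fM fM' ff'; apply/funext => g.
have f1 (k : free_group d -> H) : {morph k : g h / g * h} -> k 1 = 1.
  by move=> kM; apply: (mulgI (k 1)); rewrite -kM !mulg1.
rewrite [g]free_group_prod; elim: (word g) => [|x w IH].
  by rewrite big_nil !f1.
by rewrite big_cons fM fM' ff' IH.
Qed.
End Words.

Section Submonoid.
Variables (d : nat) (Sigma : set (free_group d)).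
Hypothesis SigmaP : Sigma `<=` [set fgen i | i in [set: 'I_d]] `|`
             [set (fgen i)^-1 | i in [set: 'I_d]].
Local Notation S := (submonoid Sigma).

Definition lettered (x : letter d) : Prop := Sigma (lgen x).

Lemma Sigma_lgen g : Sigma g -> exists2 x, lettered x & g = lgen x.
Proof.
move=> Sg; case: (SigmaP Sg) => -[i _ gE].
  by exists (i, true); rewrite /lettered lgen_true gE.
by exists (i, false); rewrite /lettered lgen_false gE.
Qed.

(** Cancellation removes letters and never creates any. *)
Lemma submonoid_word (s : S) x : x \in word (\val s) -> lettered x.
Proof.
have [w + ->] : products Sigma (\val s) by exact/set_mem/valP.
elim: w x => [|g w IH] x Sw; first by rewrite big_nil.
have [y Sy gE] : exists2 y, lettered y & g = lgen y.
  by apply/Sigma_lgen/Sw; rewrite mem_head.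
rewrite big_cons gE word_mul /= => xw.
have {}IH z : z \in word (\prod_(h <- w) h) -> lettered z.
  by apply: IH => h hw; apply: Sw; rewrite inE hw orbT.
move: xw; rewrite /push; case: (word _) IH => [|z u] IH.
  by rewrite inE => /eqP->.
case: eqP => _ xu; first by apply: IH; rewrite inE xu orbT.
by move: xu; rewrite inE => /orP[/eqP->//|/IH].
Qed.

Lemma products_lettered g :
  (forall x, x \in word g -> lettered x) -> products Sigma g.
Proof.
move=> gS; exists [seq lgen x | x <- word g].
  by move=> _ /mapP[x xg ->]; exact: gS.
by rewrite big_map; exact: free_group_prod.
Qed.

Definition to_submonoid g (gS : products Sigma g) : S :=
  Sub g (mem_set gS).

Lemma lettered_products x : lettered x -> products Sigma (lgen x).
Proof. by move=> Sx; apply: products_lettered => y; rewrite inE => /eqP->. Qed.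

Lemma submonoid_rcons (s : S) w x : word (\val s) = rcons w x ->
  exists2 s1 : S, word (\val s1) = w &
    exists2 a : S, \val a = lgen x & s = s1 * a.
Proof.
move=> sE.
have rwx : reduced (rcons w x) by rewrite -sE word_reduced.
have rw : reduced w by move: rwx; rewrite /reduced -cats1 => /cat_sorted2[].
have Sw y : y \in rcons w x -> lettered y by rewrite -sE; exact: submonoid_word.
have wS : products Sigma (FreeGroup rw).
  by apply: products_lettered => y /= yw; apply: Sw; rewrite mem_rcons inE yw orbT.
have xS : products Sigma (lgen x).
  by apply/lettered_products/Sw; rewrite mem_rcons mem_head.
exists (to_submonoid wS) => //; exists (to_submonoid xS) => //.
apply: val_inj; rewrite [\val s]free_group_prod sE big_rcons /=.
by rewrite word_prod.
Qed.

(** * The free S-group *)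

Definition avoids (i : 'I_d) : {pred free_group d} :=
  fun g => all (fun x : letter d => x.1 != i) (word g).

Lemma avoids_group_closed i : group_closed (avoids i).
Proof.
have aV g : avoids i g -> avoids i g^-1.
  move=> ig; rewrite /avoids /= /winv all_rev all_map.
  by apply: sub_all ig.
have aM g h : avoids i g -> avoids i h -> avoids i (g * h).
  rewrite /avoids word_mul => + ih; elim: (word g) => //= x w IH /andP[xi /IH].
  case: (foldr _ _ _) => [|y u] /=; first by rewrite xi.
  by case: (y =P linv x) => _ /= /andP[yi ui]; rewrite ?ui// xi yi.
split=> // g h gi hi; apply: aM => //; exact: aV.
Qed.

(** If neither a_i nor its inverse is in Sigma, then S lies in the subgroup of
    the words that avoid the index i. *)
Lemma Sgroup_letters : is_Sgroup (submonoid_incl Sigma) ->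
  forall i : 'I_d, Sigma (fgen i) \/ Sigma (fgen i)^-1.
Proof.
move=> [_ gen] i; apply: contrapT => /not_orP[nS nSV].
suff : fgen i \in avoids i by rewrite unfold_in /avoids /= eqxx.
apply: gen => [|s]; first exact: avoids_group_closed.
rewrite unfold_in; apply/allP => -[j b] /submonoid_word /= Sj.
apply/eqP => ji; subst j; case: b Sj; rewrite /lettered.
  by rewrite lgen_true.
by rewrite lgen_false.
Qed.

Section AllLetters.
Hypothesis allS : forall i : 'I_d, Sigma (fgen i) \/ Sigma (fgen i)^-1.

Lemma letters_Sgroup : is_Sgroup (submonoid_incl Sigma).
Proof.
split=> // H [H1 HVM] HS g.
have HV x : x \in H -> x^-1 \in H.
  by move=> Hx; rewrite -[_^-1]mul1g; exact: HVM.
have HM x y : x \in H -> y \in H -> x * y \in H.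
  by move=> Hx Hy; rewrite -[y]invgK; apply: HVM => //; exact: HV.
have Hgen i : fgen i \in H.
  have [Si|Si] := allS i.
    rewrite -lgen_true in Si *.
    by have := HS (to_submonoid (lettered_products Si)).
  rewrite -[fgen i]invgK; apply: HV; rewrite -lgen_false in Si *.
  by have := HS (to_submonoid (lettered_products Si)).
rewrite [g]free_group_prod; elim: (word g) => [|[i b] w IH].
  by rewrite big_nil.
rewrite big_cons; apply: HM => //; case: b; first by rewrite lgen_true.
by rewrite lgen_false; apply: HV.
Qed.

(** Given [eta : S -> H], each letter is sent to its image under [eta], or to
    the inverse of the image of the opposite letter, whichever is defined; when
    both are, they agree because [eta] preserves the identity. The resulting
    map on letters extends to F by letting F act on H by left translations. *)
Lemma letters_free : is_free_Sgroup (submonoid_incl Sigma).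
Proof.
split; first exact: letters_Sgroup.
move=> H eta [etaM _].
have eta1 : eta 1 = 1 by apply: (mulgI (eta 1)); rewrite -etaM !mulg1.
pose eta0 x : H := if pselect (lettered x) is left Sx
  then eta (to_submonoid (lettered_products Sx)) else 1.
have eta0E (a : S) x : \val a = lgen x -> eta0 x = eta a.
  move=> ax; rewrite /eta0; case: pselect => [Sx|[]].
    by congr eta; apply: val_inj; rewrite ax.
  by apply: (submonoid_word (s := a)); rewrite ax mem_head.
pose gen x : H := if pselect (lettered x) is left _ then eta0 x
  else (eta0 (linv x))^-1.
have genV x : gen (linv x) = (gen x)^-1.
  rewrite /gen linvK; case: pselect => SVx; case: pselect => Sx; rewrite ?invgK//.
    apply: (mulIg (eta0 x)); rewrite mulVg.
    pose a := to_submonoid (lettered_products Sx).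
    pose b := to_submonoid (lettered_products SVx).
    rewrite (eta0E a x)// (eta0E b (linv x))// -etaM -eta1; congr eta.
    by apply: val_inj; rewrite /= lgen_linv mulVg.
  by case: (allS x.1); rewrite -?lgen_false -?lgen_true => Si;
    case: (x) SVx Sx Si => j [].
pose theta g : H := word_act (fun x h => gen x * h) g 1.
have thetaE g h : word_act (fun x h => gen x * h) g h = theta g * h.
  rewrite /theta /word_act; elim: (word g) => [|x w IH] /=; first by rewrite mul1g.
  by rewrite IH mulgA.
have thetaM : {morph theta : g h / g * h}.
  move=> g h; rewrite -thetaE /theta word_actM// => x k.
  by rewrite genV mulKg.
have eta_lgen (a : S) x : \val a = lgen x -> theta (\val a) = eta a.
  move=> ax; have Sx : lettered x.
    by apply: (submonoid_word (s := a)); rewrite ax mem_head.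
  rewrite ax /theta /word_act /= mulg1 /gen; case: pselect => // _.
  exact: eta0E.
exists theta; split.
  split=> //; apply/funext => s /=; rewrite /submonoid_incl.
  move: {-1}(word _) (erefl (word (\val s))) => w.
  elim/last_ind: w s => [|w x IH] s sE.
    have -> : s = 1 by apply/val_inj/word_inj; rewrite sE.
    by rewrite eta1.
  have [s1 s1w [a ax ->]] := submonoid_rcons sE.
  by rewrite etaM -(IH s1)// -(eta_lgen a x)// -thetaM.
move=> theta' [theta'M thetaE']; apply: morph_letters => // x.
have lE y : lettered y -> theta (lgen y) = theta' (lgen y).
  move=> Sy; pose a := to_submonoid (lettered_products Sy).
  have := congr1 (@^~ a) thetaE'.
  by rewrite /= /submonoid_incl /= => ->; exact: (eta_lgen a).
have thV (f : free_group d -> H) g :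
    {morph f : g h / g * h} -> f g^-1 = (f g)^-1.
  move=> fM; apply: (mulIg (f g)); rewrite -fM !mulVg.
  by apply: (mulgI (f 1)); rewrite -fM !mulg1.
have [Sx|nSx] := pselect (lettered x); first exact: lE.
apply: invg_inj; rewrite -!thV// -lgen_linv; apply: lE.
by case: (allS x.1); rewrite -?lgen_false -?lgen_true; case: (x) nSx => j [].
Qed.
End AllLetters.
End Submonoid.

(** * Finite windows in a full shift *)

(** Windows are lists, so that the patterns on a window are tuples over the
    alphabet and form a finite type. *)
Definition exhaustion (T : choiceType) (B : nat -> seq T) : Prop :=
  (forall n m, (n <= m)%N -> {subset B n <= B m}) /\
  (forall t, exists n, t \in B n).

Section Windows.
Variables (T : choiceType) (A : alphabetType) (B : nat -> seq T).
Local Notation X := (fullshift T A).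
Implicit Types (x y : X) (D : set X).

Definition pattern n x : (size (B n)).-tuple A := map_tuple x (in_tuple (B n)).

Lemma eq_patternP n x y : pattern n x = pattern n y <-> {in B n, x =1 y}.
Proof.
split=> [/(congr1 val) /= /eq_in_map//|xy].
by apply: val_inj => /=; apply/eq_in_map.
Qed.

Definition local n D := forall x y, pattern n x = pattern n y -> D x -> D y.

Definition windowed : set (set X) := [set D | exists n, local n D].

Lemma local_pattern n p : local n (pattern n @^-1` [set p]).
Proof. by move=> x y /= ->. Qed.

Lemma localC n D : local n D -> local n (~` D).
Proof. by move=> Dn x y xy nDx Dy; apply: nDx; apply: Dn Dy. Qed.

Lemma localI n D E : local n D -> local n E -> local n (D `&` E).
Proof. by move=> Dn En x y xy [/(Dn _ _ xy) + /(En _ _ xy)]. Qed.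

Lemma nbhs_coordinate x t : nbhs x [set y : X | y t = x t].
Proof.
have /cvg_sup/(_ t) : nbhs x --> x by exact: cvg_id.
apply; exists [set y : X | y t = x t]; split => //.
exists [set x t]; last by apply/seteqP; split.
exact: discrete_open.
Qed.

Lemma nbhs_pattern n x : nbhs x [set y | pattern n x = pattern n y].
Proof.
suff : nbhs x [set y : X | {in B n, x =1 y}].
  by apply: filterS => y /eq_patternP.
elim: (B n) => [|t s IH]; first by apply: filterS filterT => y _ t; rewrite in_nil.
apply: filterS (filterI IH (nbhs_coordinate x t)) => y [xy yx] u.
by rewrite inE => /orP[/eqP->|/xy].
Qed.

Lemma open_local n D : local n D -> open D.
Proof.
move=> Dn; rewrite openE => x Dx; apply: filterS (nbhs_pattern n x) => y xy.
exact: Dn Dx.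
Qed.

Lemma clopen_local n D : local n D -> clopen D.
Proof.
move=> Dn; split; first exact: open_local Dn.
by rewrite -openC; apply/(@open_local n)/localC.
Qed.

Lemma measurable_local n D : local n D -> measurable (D : set (borel X)).
Proof. by move=> Dn; apply: sub_sigma_algebra; exact: open_local Dn. Qed.

Lemma measurable_pattern n p :
  measurable (pattern n @^-1` [set p] : set (borel X)).
Proof. by apply: measurable_local; exact: local_pattern. Qed.

Lemma compact_fullshift : compact [set: X].
Proof.
have -> : [set: X] = [set f : {ptws T -> discrete_topology A} |
    forall t, [set: discrete_topology A] (f t)].
  by apply/seteqP; split.
apply: (@tychonoff T (fun=> discrete_topology A) (fun=> setT)) => t.
by apply: finite_compact; exact: (@finite_finset A).
Qed.

Section Exhaustion.
Hypothesis exB : exhaustion B.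

Lemma eq_pattern_le n m x y : (n <= m)%N ->
  pattern m x = pattern m y -> pattern n x = pattern n y.
Proof. by move=> nm /eq_patternP xy; apply/eq_patternP => t /(exB.1 _ _ nm)/xy. Qed.

Lemma local_le n m D : (n <= m)%N -> local n D -> local m D.
Proof. by move=> nm Dn x y /(eq_pattern_le nm); exact: Dn. Qed.

Lemma setI_closed_windowed : setI_closed windowed.
Proof.
move=> D E [n Dn] [m Em]; exists (maxn n m); apply: localI.
  by apply: local_le Dn; rewrite leq_maxl.
by apply: local_le Em; rewrite leq_maxr.
Qed.

Lemma nbhs_local x U : nbhs x U ->
  exists n, forall y, pattern n x = pattern n y -> U y.
Proof.
pose F : set_system X :=
  filter_from [set: nat] (fun n => [set y | pattern n x = pattern n y]).
have FF : Filter F.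
  apply: filter_from_filter; first by exists 0%N.
  move=> i j _ _; exists (maxn i j) => // y xy.
  by split; apply: eq_pattern_le xy; rewrite ?leq_maxl ?leq_maxr.
suff Fx : F --> x by move=> /Fx[n _ nU]; exists n => y /nU.
apply/cvg_sup => t V [W] [] [C oC <-] /= Cxt sWV.
have [n tn] := exB.2 t; exists n => // y /eq_patternP xy.
by apply: sWV; rewrite /= -xy.
Qed.

Lemma open_bigcup_local (U : set X) : open U ->
  U = \bigcup_n [set x | forall y, pattern n x = pattern n y -> U y].
Proof.
rewrite openE => oU; apply/seteqP; split=> [x /oU /nbhs_local[n nU]|x [n _]].
  by exists n.
exact.
Qed.

(** The windows being countably many, an open set is a countable union of local
    sets. *)
Lemma borel_windowed (D : set (borel X)) : measurable D -> <<s windowed >> D.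
Proof.
apply: smallest_sub; first exact: smallest_sigma_algebra.
move=> U /open_bigcup_local ->.
apply: (@bigcup_measurable _ (g_sigma_algebraType windowed)) => n _.
apply: sub_sigma_algebra; exists n => x y xy xU z yz.
by apply: xU; rewrite xy.
Qed.

Lemma borel_measure_unique (R : realType)
    (mu nu : {measure set (borel X) -> \bar R}%R) :
  (mu setT < +oo)%E ->
  (forall n D, local n D -> mu D = nu D) ->
  forall D : set (borel X), measurable D -> mu D = nu D.
Proof.
move=> fmu munu D /borel_windowed wD.
apply: (@g_sigma_algebra_measure_unique _ R (borel X) windowed _ (fun=> setT)) => //.
- by move=> E [n /measurable_local].
- by move=> _; exists 0%N.
- by rewrite bigcup_const.
- exact: setI_closed_windowed.
- by move=> E [n En]; apply: munu En.
Qed.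

(** Every point has a window through which [f] is determined up to [e];
    the sets of points for which the window [n] suffices are open and increase
    to the whole space, so by compactness one window suffices. *)
Lemma fullshift_uniform (R : realType) (f : X -> R) (e : R) : continuous f ->
  (0 < e)%R ->
  exists n, forall x y, pattern n x = pattern n y -> (`|f x - f y| <= e)%R.
Proof.
move=> cf e0.
pose U n := [set x | forall y z, pattern n x = pattern n y ->
  pattern n x = pattern n z -> (`|f y - f z| <= e)%R].
have Ux x : exists n, U n x.
  have /cvgr_dist_le/(_ (e / 2)%R) := cf x.
  rewrite divr_gt0// => /(_ isT) /nbhs_local[n xn].
  exists n => y z /xn /= xy /xn /= xz.
  by rewrite (splitr e) (le_trans (ler_distD (f x) _ _))// lerD// distrC.
have := compact_fullshift; rewrite compact_cover => /(_ _ setT U); case.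
- move=> n _; apply: (@open_local n) => x y xy Ux' z w yz yw.
  by apply: Ux'; rewrite xy.
- by move=> x _; have [n] := Ux x; exists n.
move=> N _ cN; exists (\max_(i : N) val i) => x y xy.
have [i /= iN Uix] := cN x I.
have le_i : (i <= \max_(i : N) val i)%N.
  exact: (@leq_bigmax _ _ [` iN]%fset).
by apply: Uix => //; apply: eq_pattern_le xy.
Qed.
End Exhaustion.
End Windows.

(** Precomposition with [eta] covers both the shift maps, where [eta] is a
    right translation, and the restriction to S, where it is the inclusion. *)
Section Reindexing.
Variables (T T' : choiceType) (A : alphabetType).
Variables (B : nat -> seq T) (B' : nat -> seq T').
Hypotheses (exB : exhaustion B) (exB' : exhaustion B').
Variable eta : T' -> T.
Local Notation X := (fullshift T A).
Local Notation X' := (fullshift T' A).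

Definition reindex (x : X) : X' := x \o eta.

Lemma windowed_reindex D : windowed B' D -> windowed B (reindex @^-1` D).
Proof.
move=> [n Dn].
suff [m mP] : exists m, {in B' n, forall t, eta t \in B m}.
  exists m => x y /eq_patternP xy; apply: Dn; apply/eq_patternP => t tn.
  exact/xy/mP.
elim: (B' n) => [|t s [m mP]]; first by exists 0%N => t; rewrite in_nil.
have [k tk] := exB.2 (eta t).
exists (maxn m k) => u; rewrite inE => /orP[/eqP->|/mP um].
  by apply: exB.1 tk; rewrite leq_maxr.
by apply: exB.1 um; rewrite leq_maxl.
Qed.

Lemma measurable_reindex : measurable_fun setT (reindex : borel X -> borel X').
Proof.
apply: (@measurability _ _ (borel X) (borel X') _ _ (windowed B')).
  apply/seteqP; split; first by move=> D; exact: borel_windowed.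
  apply: smallest_sub; first exact: smallest_sigma_algebra.
  by move=> D [n Dn]; apply: measurable_local Dn.
by move=> _ [D /windowed_reindex[n Dn] <-]; rewrite setTI; apply: measurable_local Dn.
Qed.

Lemma measurable_preimage_reindex (D : set (borel X')) : measurable D ->
  measurable (reindex @^-1` D : set (borel X)).
Proof. by move=> mD; rewrite -[_ @^-1` _]setTI; exact: measurable_reindex. Qed.
End Reindexing.

(** * Weak-* convergence and convergence on local sets *)

Section Mass.
Variables (R : realType) (X : ptopologicalType).
Implicit Types (mu : prob R X).

Definition mass mu (D : set X) : R := fine (mu D).

Lemma massE mu D : measurable (D : set (borel X)) -> mu D = (mass mu D)%:E.
Proof. by move=> mD; rewrite /mass fineK// fin_num_measure. Qed.

Lemma mass_ge0 mu D : (0 <= mass mu D)%R.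
Proof. by rewrite fine_ge0. Qed.

Lemma massT mu : mass mu setT = 1%R.
Proof. by rewrite /mass probability_setT. Qed.

Lemma mass_sum mu (Q : finType) (f : X -> Q) (P : pred Q) :
  (forall q, measurable (f @^-1` [set q] : set (borel X))) ->
  mass mu [set x | P (f x)] = (\sum_(q | P q) mass mu (f @^-1` [set q]))%R.
Proof.
move=> mf.
have -> : [set x | P (f x)] = \bigcup_(q in [set` enum P]) (f @^-1` [set q]).
  apply/seteqP; split=> [x Px|x [q /=]]; last by rewrite mem_enum => Pq ->.
  by exists (f x) => //=; rewrite mem_enum.
rewrite /mass measure_fin_bigcup//=; last by move=> p q _ _ [x [/= ->]].
rewrite -fsbig_seq ?enum_uniq// big_enum /= sum_fine//.
by move=> q _; exact: fin_num_measure.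
Qed.
End Mass.

Lemma continuous_measurable_borel (R : realType) (X : ptopologicalType)
    (f : X -> R) :
  continuous f -> measurable_fun setT (f : borel X -> R).
Proof.
move=> /continuousP cf; apply: (measurability _ (RGenOInfty.measurableE R)).
move=> _ [_ [x ->] <-]; rewrite setTI; apply: sub_sigma_algebra.
by apply: cf; exact: interval_open.
Qed.

Lemma bounded_integrable (R : realType) (X : ptopologicalType) (mu : prob R X)
    (f : X -> R) M :
  measurable_fun setT (f : borel X -> R) ->
  (forall x, `|f x| <= M)%R -> mu.-integrable setT (EFin \o f).
Proof.
move=> mf fM; apply: measurable_bounded_integrable => //.
  by rewrite (le_lt_trans (probability_le1 _ _))// ltry.
exists M; split; first exact: num_real.
by move=> K MK x _ /=; apply: le_trans (fM x) (ltW MK).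
Qed.

Section Integrals.
Variables (R : realType) (T : choiceType) (A : alphabetType) (B : nat -> seq T).
Local Notation X := (fullshift T A).
Local Notation pattern n := (@pattern T A B n).
Local Notation local n := (@local T A B n).
Implicit Types (mu nu : prob R X) (f : X -> R).

Section Approximation.
Variables (n : nat) (f : X -> R) (e : R).
Hypothesis cf : continuous f.
Hypothesis fn : forall x y, pattern n x = pattern n y -> (`|f x - f y| <= e)%R.

Let rep p := xget point (pattern n @^-1` [set p]).

Let pattern_rep x : pattern n x = pattern n (rep (pattern n x)).
Proof. by rewrite /rep; case: xgetP => [y _ /= ->//|/(_ x)[]]. Qed.

Let f_bounded x :
  (`|f x| <= e + \sum_(p : (size (B n)).-tuple A) `|f (rep p)|)%R.
Proof.
rewrite -[f x](subrK (f (rep (pattern n x)))).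
rewrite (le_trans (ler_normD _ _))// lerD//; first exact: fn.
by rewrite (bigD1 (pattern n x))//= lerDl sumr_ge0.
Qed.

(** [f] is within [e] of the step function that takes, on each class of points
    with the same pattern, the value of [f] at one point of the class. *)
Lemma integral_approx mu :
    (`| \int[mu]_x f x -
       \sum_p f (rep p) * mass mu (pattern n @^-1` [set p])| <= e)%R.
Proof.
pose D p : set (borel X) := pattern n @^-1` [set p].
have mD p : measurable (D p) by exact: measurable_pattern.
pose h p x : R := (f (rep p) * \1_(D p) x)%R.
have mh p : measurable_fun setT (h p : borel X -> R).
  by apply: measurable_funM => //; exact: measurable_indic.
have i1 p : mu.-integrable setT (EFin \o (\1_(D p) : X -> R)%R).
  apply: (@bounded_integrable _ _ _ _ 1%R); first exact: measurable_indic.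
  by move=> x; rewrite ger0_norm indicE ?ler0n// lern1 leq_b1.
pose g x : R := (\sum_p h p x)%R.
have gE x : g x = f (rep (pattern n x)).
  rewrite /g (bigD1 (pattern n x))//= big1 ?addr0; last first.
    by move=> p; rewrite eq_sym => /eqP xp; rewrite /h indicE memNset ?mulr0//.
  by rewrite /h indicE mem_set ?mulr1.
have mg : measurable_fun setT (g : borel X -> R) by apply: measurable_sum.
have ig : mu.-integrable setT (EFin \o g).
  apply: (@bounded_integrable _ _ _ _
    (e + \sum_(p : (size (B n)).-tuple A) `|f (rep p)|)%R mg) => x.
  by rewrite gE; exact: f_bounded.
have iF : mu.-integrable setT (EFin \o f).
  by apply: bounded_integrable f_bounded; exact: continuous_measurable_borel.
have -> : (\sum_p f (rep p) * mass mu (D p) = \int[mu]_x g x)%R.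
  rewrite /g; suff /(_ (index_enum _))[] : forall r,
      mu.-integrable setT (EFin \o (fun x => \sum_(p <- r) h p x)%R) /\
      (\sum_(p <- r) f (rep p) * mass mu (D p) =
       \int[mu]_x \sum_(p <- r) h p x)%R.
    by [].
  elim=> [|p r [ir rE]].
    under eq_fun do rewrite big_nil.
    by rewrite big_nil Rintegral_cst// mul0r; split=> //; exact: integrable0.
  have hE x : (\sum_(q <- p :: r) h q x = h p x + \sum_(q <- r) h q x)%R.
    by rewrite big_cons.
  under eq_fun do rewrite hE.
  have ip : mu.-integrable setT (EFin \o h p).
    apply: (@bounded_integrable _ _ _ _ `|f (rep p)|%R) => // x.
    by rewrite normrM ler_piMr// indicE ger0_norm ?ler0n// lern1 leq_b1.
  split; first by have := integrableD measurableT ip ir; apply: eq_integrable.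
  rewrite big_cons rE RintegralD//; congr (_ + _)%R.
  rewrite RintegralZl//; congr (_ * _)%R.
  by rewrite /Rintegral integral_indic// setIT.
rewrite -RintegralB//.
have mfg : measurable_fun setT (fun x : borel X => f x - g x)%R.
  by apply: measurable_funB => //; exact: continuous_measurable_borel.
have fg x : (`|f x - g x| <= e)%R by rewrite gE; exact: fn.
apply: le_trans (le_normr_Rintegral _ _) _ => //.
  exact: bounded_integrable mfg fg.
have -> : e = (\int[mu]_x e)%R.
  by rewrite Rintegral_cst// [fine _](massT mu) mulr1.
apply: le_Rintegral => //.
- apply: (@bounded_integrable _ _ _ _ e); last by move=> x; rewrite normr_id.
  apply: (measurableT_comp (@normr_measurable R _) mfg).
- by apply: (@bounded_integrable _ _ _ _ `|e|%R).
Qed.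
End Approximation.

Hypothesis exB : exhaustion B.

Lemma cvg_integral (nu : nat -> prob R X) mu f : continuous f ->
  (forall n D, local n D -> mass (nu k) D @[k --> \oo] --> mass mu D) ->
  (\int[nu k]_x f x)%R @[k --> \oo] --> (\int[mu]_x f x)%R.
Proof.
move=> cf cvD; apply/cvgrPdist_le => e e0.
have e3 : (0 < e / 3)%R by rewrite divr_gt0.
have [n fn] := fullshift_uniform exB cf e3.
pose s (lambda : prob R X) :=
  (\sum_p f (xget point (pattern n @^-1` [set p])) *
    mass lambda (pattern n @^-1` [set p]))%R.
have sP := integral_approx cf fn.
have cvs : s (nu k) @[k --> \oo] --> s mu.
  apply: cvg_big => [|p _]; first exact: add_continuous.
  by apply: cvgMl_tmp; apply: cvD; exact: local_pattern.
move/cvgrPdist_le : cvs => /(_ _ e3) cvs; near=> k.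
have -> : (\int[mu]_x f x - \int[nu k]_x f x = (\int[mu]_x f x - s mu) +
  (s mu - s (nu k)) - (\int[nu k]_x f x - s (nu k)))%R by ring.
have -> : (e = e / 3 + e / 3 + e / 3)%R by field.
rewrite (le_trans (ler_normB _ _))// lerD//.
rewrite (le_trans (ler_normD _ _))// lerD//.
by near: k.
Unshelve. all: by end_near. Qed.

Lemma cvg_prob (nu : nat -> prob R X) mu :
  (forall n D, local n D -> mass (nu k) D @[k --> \oo] --> mass mu D) ->
  nu @ \oo --> mu.
Proof.
move=> cvD U [_ [[W oW <-] /= Wmu] WU].
have cW : integrals (nu k) @[k --> \oo] -->
    (integrals mu : {ptws continuousType X R -> R}).
  apply/cvg_sup => f V [_ [[Q oQ <-] /= Qf] QV].
  have cf : continuous (f : X -> R) by exact: cts_fun.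
  have /(_ Q (open_nbhs_nbhs (conj oQ Qf))) Qk := cvg_integral cf cvD.
  by apply: (@filterS _ \oo _ _ _ _ Qk) => k; exact: QV.
have /(_ W (open_nbhs_nbhs (conj oW Wmu))) Wk := cW.
by apply: (@filterS _ \oo _ _ _ _ Wk) => k; exact: WU.
Qed.
End Integrals.

(** * Measures from finitely additive functions of clopen sets *)

Definition clopen_display : Type -> measure_display. Proof. exact. Qed.

(** An alias of [X] whose measurable sets are the clopen sets, which form an
    algebra but in general not a sigma-algebra. *)
Definition clopen_algebra (X : ptopologicalType) : Type := X.

Section ClopenAlgebra.
Variable X : ptopologicalType.

Lemma clopen_set0 : @clopen X set0. Proof. exact: clopen0. Qed.

Lemma clopen_setU : setU_closed (@clopen X).
Proof. by move=> D E; exact: clopenU. Qed.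

Lemma clopen_setC : setC_closed (@clopen X).
Proof. by move=> D; exact: clopenC. Qed.

HB.instance Definition _ := Pointed.on (clopen_algebra X).
HB.instance Definition _ := isAlgebraOfSets.Build (clopen_display X)
  (clopen_algebra X) clopen_set0 clopen_setU clopen_setC.
End ClopenAlgebra.

Section ClopenExtension.
Variables (R : realType) (X : ptopologicalType) (m : set X -> R).
Hypothesis cX : compact [set: X].
Hypothesis m_ge0 : forall D, (0 <= m D)%R.
Hypothesis mT : m setT = 1%R.
Hypothesis mU : forall D E, clopen D -> clopen E -> D `&` E = set0 ->
  m (D `|` E) = (m D + m E)%R.

Definition clopen_content (D : set (clopen_algebra X)) : \bar R := (m D)%:E.

Let m0 : m set0 = 0%R.
Proof.
have := mU clopen0 clopen0 (setI0 _); rewrite setU0 => /eqP.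
by rewrite -subr_eq0 opprD addNKr oppr_eq0 => /eqP.
Qed.

Let content_ge0 D : (0 <= clopen_content D)%E.
Proof. by rewrite lee_fin. Qed.

Let content_additive : measure_function.semi_additive clopen_content.
Proof.
apply/additive2P; first by rewrite /clopen_content m0.
by move=> D E mD mE DE; rewrite /clopen_content mU.
Qed.

HB.instance Definition _ := isContent.Build _ (clopen_algebra X) R
  clopen_content content_ge0 content_additive.

(** A countable cover of a clopen set by clopen sets has a finite subcover. *)
Let content_sigma_subadditive :
  measurable_subset_sigma_subadditive clopen_content.
Proof.
move=> D F mF mD DF.
have cD : compact (D : set X) by apply: (subclosed_compact _ cX); [case: mD|].
have := cD; rewrite compact_cover => /(_ nat setT F) [].
- by move=> n _; case: (mF n).
- by [].
move=> N _ cN; pose n := (\max_(i : N) val i).+1.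
have DFn : D `<=` \big[setU/set0]_(i < n) F i.
  move=> x /cN[i /= iN Fix]; rewrite -bigcup_mkord; exists i => //=.
  by rewrite ltnS; exact: (@leq_bigmax _ _ [` iN]%fset).
apply: le_trans (nneseries_lim_ge n _) => //.
by rewrite big_mkord; apply: content_subadditive => // k _; exact: mF.
Qed.

HB.instance Definition _ := Content_SigmaSubAdditive_isMeasure.Build _ R
  (clopen_algebra X) clopen_content content_sigma_subadditive.

Hypothesis openX : forall U : set X, open U -> <<s @clopen X >> U.

(** The extension lives on the sigma-algebra generated by the clopen sets; it
    is read here on the Borel sigma-algebra, which is the same by [openX]. *)
Definition clopen_measure (D : set (borel X)) : \bar R :=
  measure_extension clopen_content D.

Let borel_clopen D :
  (measurable : set (set (borel X))) D -> <<s @clopen X >> D.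
Proof. by apply: smallest_sub => //; exact: smallest_sigma_algebra. Qed.

Lemma clopen_measureE D : clopen D -> clopen_measure D = (m D)%:E.
Proof.
by move=> cD; rewrite /clopen_measure /measure_extension measurable_mu_extE.
Qed.

Let clopen_measure0 : clopen_measure set0 = 0%E.
Proof. exact: measure0. Qed.

Let clopen_measure_ge0 D : (0 <= clopen_measure D)%E.
Proof. exact: measure_ge0. Qed.

Let clopen_measure_sigma_additive : semi_sigma_additive clopen_measure.
Proof.
move=> F mF tF mUF; rewrite /clopen_measure.
by apply: measure_semi_sigma_additive => // [i|]; exact: borel_clopen.
Qed.

HB.instance Definition _ := isMeasure.Build _ (borel X) R clopen_measure
  clopen_measure0 clopen_measure_ge0 clopen_measure_sigma_additive.

Let clopen_measureT : clopen_measure setT = 1%E.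
Proof. by rewrite clopen_measureE ?mT//; exact: clopenT. Qed.

HB.instance Definition _ := Measure_isProbability.Build _ (borel X) R
  clopen_measure clopen_measureT.

Lemma clopen_content_extension :
  exists mu : prob R X, forall D, clopen D -> mu D = (m D)%:E.
Proof.
by exists (clopen_measure : probability (borel X) R); exact: clopen_measureE.
Qed.
End ClopenExtension.

(** * Empirical measures *)

Section Frequency.
Variables (R : realType) (N : nat) (X : Type) (y : 'I_N -> X).
Definition freq (D : set X) : R := (N%:R^-1 * \sum_v \1_D (y v))%R.
End Frequency.
Arguments freq R {N X} y D.

Section FrequencyTheory.
Variables (R : realType) (N : nat) (X : Type) (y : 'I_N.+1 -> X).
Implicit Types D E : set X.

Lemma freq_ge0 D : (0 <= freq R y D)%R.
Proof. by rewrite mulr_ge0// sumr_ge0// => u _; rewrite indicE. Qed.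

Lemma freqT : freq R y setT = 1%R.
Proof.
rewrite /freq (eq_bigr (fun=> 1%R)) => [|u _]; last by rewrite indicT.
by rewrite sumr_const card_ord mulVf// pnatr_eq0.
Qed.

Lemma freqU D E : D `&` E = set0 ->
  freq R y (D `|` E) = (freq R y D + freq R y E)%R.
Proof.
move=> DE; rewrite /freq -mulrDr -big_split; congr (_ * _)%R.
apply: eq_bigr => u _; rewrite !indicE in_setU.
have : ~ ((D `&` E) (y u)) by rewrite DE.
case: (boolP (y u \in D)) => [|_]; case: (boolP (y u \in E)) => [|_];
  rewrite ?inE /= ?add0r ?addr0//.
by move=> Eu Du [].
Qed.

Lemma freq_le1 D : (freq R y D <= 1)%R.
Proof.
rewrite -freqT -(setUv D) freqU; first by rewrite lerDl freq_ge0.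
by rewrite setICr.
Qed.

Lemma freq_perm (f : X -> X) (rho : 'S_N.+1) D :
  (forall u, f (y u) = y (rho u)) -> freq R y (f @^-1` D) = freq R y D.
Proof.
move=> fy; rewrite /freq [in RHS](reindex_inj (@perm_inj _ rho)); congr (_ * _)%R.
by apply: eq_bigr => u _; rewrite -fy !indicE.
Qed.
End FrequencyTheory.

Section Empirical.
Variables (R : realType) (X : ptopologicalType) (N : nat) (y : 'I_N.+1 -> X).

Let N0 : (0 <= N.+1%:R^-1 :> R)%R. Proof. by []. Qed.

Definition empirical : set (borel X) -> \bar R :=
  mscale (NngNum N0) (msum (fun k => dirac (y (inord k) : borel X)) N.+1).

Lemma empiricalE D : empirical D = (freq R y D)%:E.
Proof.
rewrite /empirical /mscale /= /msum /freq EFinM -sumEFin; congr (_ * _)%E.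
by apply: eq_bigr => u _; rewrite /= /dirac inord_val.
Qed.

HB.instance Definition _ := Measure.on empirical.

Let empiricalT : empirical setT = 1%E. Proof. by rewrite empiricalE freqT. Qed.

HB.instance Definition _ := Measure_isProbability.Build _ (borel X) R
  empirical empiricalT.

Lemma empirical_prob : exists nu : prob R X, forall D, nu D = (freq R y D)%:E.
Proof. by exists (empirical : probability (borel X) R); exact: empiricalE. Qed.
End Empirical.

Lemma finite_support_freq (R : realType) (T : choiceType) (A : alphabetType)
    (N : nat) (y : 'I_N.+1 -> fullshift T A) (nu : prob R (fullshift T A)) :
  (forall D, nu D = (freq R y D)%:E) -> finite_set (Defs.support nu).
Proof.
move=> nuE; apply: (@sub_finite_set _ _ (range y)); last exact: finite_image.
move=> x xnu; apply: contrapT => nyx.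
have nx : nbhs x [set z | forall u, z != y u].
  apply: (@filter_forall _ _ (fun u z => z != y u) (nbhs x)) => u.
  have [t xt] : exists t, x t <> y u t.
    apply/existsNP => xy; apply: nyx; exists u => //.
    by apply/funext => t; rewrite xy.
  apply: filterS (nbhs_coordinate x t) => z /= zt; apply/eqP => zy.
  by apply: xt; rewrite -zt zy.
move: nx; rewrite nbhsE => -[U [oU Ux] Uy].
have := xnu U oU Ux; rewrite nuE /freq big1 ?mulr0 ?ltxx// => u _.
by rewrite indicE memNset// => /Uy/(_ u); rewrite eqxx.
Qed.

(** * Finite models of an invariant measure *)

Section Balls.
Variables (d : nat) (Sigma : set (free_group d)).
Local Notation S := (submonoid Sigma).

Definition word_ball n : seq (free_group d) :=
  pmap insub (flatten
    [seq [seq val w | w <- enum {: k.-tuple (letter d)}] | k <- iota 0 n.+1]).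

Lemma mem_word_ball n g : (g \in word_ball n) = (size (word g) <= n)%N.
Proof.
rewrite /word_ball mem_pmap_sub; apply/flatten_mapP/idP => [[k]|gn].
  by rewrite mem_iota add0n ltnS /= => kn /mapP[w _ ->]; rewrite size_tuple.
exists (size (word g)); first by rewrite mem_iota add0n ltnS.
by apply/mapP; exists (in_tuple (word g)); rewrite ?mem_enum.
Qed.

Definition sub_ball n : seq S := undup (pmap insub (word_ball n)).

Lemma mem_sub_ball n (s : S) : (s \in sub_ball n) = (size (word (\val s)) <= n)%N.
Proof. by rewrite mem_undup mem_pmap_sub mem_word_ball. Qed.

Lemma word_ball_exhaustion : exhaustion word_ball.
Proof.
split=> [n m nm g|g]; first by rewrite !mem_word_ball => /leq_trans->.
by exists (size (word g)); rewrite mem_word_ball.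
Qed.

Lemma sub_ball_exhaustion : exhaustion sub_ball.
Proof.
split=> [n m nm s|s]; first by rewrite !mem_sub_ball => /leq_trans->.
by exists (size (word (\val s))); rewrite mem_sub_ball.
Qed.
End Balls.

Section FiniteModels.
Variables (R : realType) (d : nat) (Sigma : set (free_group d)).
Hypothesis SigmaP : Sigma `<=` [set fgen i | i in [set: 'I_d]] `|`
             [set (fgen i)^-1 | i in [set: 'I_d]].
Variable A : alphabetType.
Local Notation S := (submonoid Sigma).
Local Notation F := (free_group d).
Local Notation lettered := (lettered Sigma).
Local Notation X := (fullshift S A).
Variable mu : prob R X.
Hypothesis mu_inv : invariant_measures R (shift_act S A) mu.
Variable n : nat.
Local Notation B := (sub_ball Sigma).
Local Notation Q := ((size (B n)).-tuple A).
Local Notation pattern := (@pattern S A B n).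
Local Notation local := (@local S A B n).

Definition compatible (x : letter d) (p q : Q) : bool :=
  `[< exists x0 : X, exists2 a : S, \val a = lgen x &
      pattern x0 = p /\ pattern (shift_act S A a x0) = q >].

Lemma compatible_linv x p q : lettered x -> lettered (linv x) ->
  compatible x p q -> compatible (linv x) q p.
Proof.
move=> Sx SVx /asboolP[x0 [a ax [xp xq]]]; apply/asboolP.
pose b : S := to_submonoid (lettered_products SVx).
exists (shift_act S A a x0), b => //; split=> //; rewrite -xp; congr pattern.
apply/funext => t; rewrite /shift_act -mulgA; congr (x0 _).
by apply: val_inj; rewrite /= ax lgen_linv mulVg mulg1.
Qed.

Definition label (p : Q) : S -> A := fun s => nth point p (index s (B n)).

Lemma label_pattern x0 s : s \in B n -> label (pattern x0) s = x0 s.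
Proof.
by move=> sB; rewrite /label /= (nth_map s) ?index_mem// nth_index.
Qed.

Lemma pattern_label p : pattern (label p) = p.
Proof.
apply: (@eq_from_tnth _ _) => i; rewrite !(tnth_nth point) /=.
rewrite (nth_map 1%g) ?ltn_ord// /label index_uniq ?ltn_ord//.
exact: undup_uniq.
Qed.

Lemma measurable_shift a (D : set (borel X)) : measurable D ->
  measurable (shift_act S A a @^-1` D : set (borel X)).
Proof.
have exS := sub_ball_exhaustion Sigma.
exact: (@measurable_preimage_reindex _ _ A _ _ exS exS (fun t => t * a)).
Qed.

Lemma mass_patterns : (\sum_p mass mu (pattern @^-1` [set p]) = 1)%R.
Proof.
rewrite -(mass_sum mu predT (fun p : Q => measurable_pattern p)) -[RHS](massT mu).
by congr (mass mu _); exact/seteqP.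
Qed.

(** The joint law of the patterns of z and of a.z under [mu] is carried by
    compatible pairs, and both its marginals are the law of the pattern of z:
    the second one by invariance. *)
Lemma edge_matching x : lettered x -> forall N (C : N.-tuple Q),
  (forall p, rounded N (fun p => mass mu (pattern @^-1` [set p])) p
     <= count_mem p C)%N ->
  exists s : 'S_N,
   (#|[pred u | ~~ compatible x (tnth C u) (tnth C (s u))]| <= #|{: Q * Q}|)%N.
Proof.
move=> Sx N C CP; pose a : S := to_submonoid (lettered_products Sx).
pose f (x0 : X) := (pattern x0, pattern (shift_act S A a x0)).
have mf p : measurable (f @^-1` [set p] : set (borel X)).
  have -> : f @^-1` [set p] = pattern @^-1` [set p.1] `&`
     (shift_act S A a @^-1` (pattern @^-1` [set p.2])).
    by case: p => p q; apply/seteqP; split=> z /= [<- <-].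
  by apply: measurableI; [|apply: measurable_shift]; exact: measurable_pattern.
pose w p := mass mu (f @^-1` [set p]).
apply: (@rounded_matching _ _ _ _ w C _ _ _ _ mass_patterns CP).
- by move=> p; exact: mass_ge0.
- move=> p; transitivity (mass mu [set z | (f z).1 == p]).
    rewrite (mass_sum mu (fun r => r.1 == p) mf).
    transitivity (\sum_(p' | p' == p) \sum_q w (p', q))%R.
      by rewrite big_pred1_eq.
    by rewrite pair_big_dep; apply: eq_big => [[p' q]|[p' q] _] //=; rewrite andbT.
  by congr (mass mu _); apply/seteqP; split=> z /= /eqP.
- move=> q; transitivity (mass mu [set z | (f z).2 == q]).
    rewrite (mass_sum mu (fun r => r.2 == q) mf).
    transitivity (\sum_(q' | q' == q) \sum_p w (p, q'))%R.
      by rewrite big_pred1_eq.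
    by rewrite exchange_big pair_big_dep; apply: eq_big => [[p' q']|[p' q'] _] //=.
  rewrite /mass -[in RHS](mu_inv a); last exact: measurable_pattern.
  by congr (fine (mu _)); apply/seteqP; split=> z /= /eqP.
- move=> [p q]; rewrite /w => w0; apply/asboolP.
  have [z [<- <-]] : (f @^-1` [set (p, q)]) !=set0.
    by apply/set0P; apply: contraTneq w0 => ->; rewrite /mass measure0 ltxx.
  by exists z, a.
Qed.

Section Model.
Variables (N : nat) (C : N.-tuple Q) (s : letter d -> 'S_N) (K : nat).
Hypothesis sP : forall x, lettered x ->
  (#|[pred u | ~~ compatible x (tnth C u) (tnth C (s x u))]| <= K)%N.

Definition gen_perm (i : 'I_d) : 'S_N :=
  if `[< lettered (i, true) >] then s (i, true) else (s (i, false))^-1.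

Definition letter_act (x : letter d) (u : 'I_N) : 'I_N :=
  (if x.2 then gen_perm x.1 else (gen_perm x.1)^-1) u.

Lemma letter_actK x : cancel (letter_act x) (letter_act (linv x)).
Proof. by case: x => i [] u; rewrite /letter_act /= ?permK ?permKV. Qed.

Definition bad x : pred 'I_N := [pred u | `[< lettered x >] &&
  ~~ compatible x (tnth C u) (tnth C (letter_act x u))].

(** When a generator and its inverse are both in Sigma, the permutation chosen
    for the first serves for both: an edge is compatible with one letter
    exactly when the reversed edge is compatible with the other. *)
Lemma card_bad x : (#|bad x| <= K)%N.
Proof.
case: (asboolP (lettered x)) => [Sx|nSx]; last first.
  by rewrite eq_card0// => u; rewrite inE /=; case: asboolP.
have E : #|bad x| =
    #|[pred u | ~~ compatible x (tnth C u) (tnth C (letter_act x u))]|.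
  by apply: eq_card => u; rewrite !inE /=; case: asboolP.
rewrite {}E; case: x Sx => i [] Sx.
  by rewrite /letter_act /gen_perm /=; case: asboolP => // _; exact: sP.
rewrite /letter_act /gen_perm /=; case: asboolP => [SVx|_]; last first.
  by rewrite invgK; exact: sP.
apply: leq_trans (sP SVx).
rewrite -(fintype.card_image (@perm_inj _ (s (i, true))^-1)).
apply/fintype.subset_leq_card/fintype.subsetP => _ /fintype.imageP[u + ->].
rewrite !inE permKV; apply: contra; exact: compatible_linv.
Qed.

Local Notation act := (word_act letter_act).

Definition model_point (u : 'I_N) : fullshift F A :=
  fun g => label (tnth C (act g u)) 1.

Lemma shift_model_point g u :
  shift_act F A g (model_point u) = model_point (act g u).
Proof.
apply/funext => h; rewrite /shift_act /model_point word_actM//.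
exact: letter_actK.
Qed.

(** Write t = t1 * a with a a letter: compatibility of the step u -> a.u says
    that the label of u at t1 * a is the label of a.u at t1. *)
Lemma label_good k u (t : S) : (k <= n)%N -> good letter_act bad k u ->
  (size (word (\val t)) <= k)%N ->
  label (tnth C u) t = label (tnth C (act (\val t) u)) 1.
Proof.
elim: k u t => [|k IH] u t kn /=.
  rewrite leqn0 size_eq0 => _ /eqP t1.
  by have -> : t = 1 by apply/val_inj/word_inj; rewrite t1.
move=> /forallP gu; move tw : (word (\val t)) => w.
case/lastP: w tw => [|w x] tw.
  by have -> : t = 1 by apply/val_inj/word_inj; rewrite tw.
rewrite size_rcons ltnS => wk.
have [t1 t1w [a ax tE]] := submonoid_rcons SigmaP tw.
have Sx : lettered x.
  by apply: (submonoid_word SigmaP (s := t)); rewrite tw mem_rcons mem_head.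
have /andP[+ gx] := gu x.
rewrite /bad /= asboolT// negbK => /asboolP[x0 [a' a'x [xp xq]]].
have aa' : a' = a by apply: val_inj; rewrite ax a'x.
have xt1 : label (tnth C u) t = label (tnth C (letter_act x u)) t1.
  rewrite -xp -xq !label_pattern ?mem_sub_ball ?t1w ?tw ?size_rcons.
  - by rewrite tE aa'.
  - exact: leq_trans wk (ltnW kn).
  - exact: leq_trans kn.
rewrite xt1 IH ?t1w//; last exact: ltnW.
by rewrite /word_act tw t1w foldr_rcons.
Qed.

Lemma restrict_good u : good letter_act bad n u ->
  pattern (restrict_along (submonoid_incl Sigma) A (model_point u)) = tnth C u.
Proof.
move=> gu; rewrite -[RHS]pattern_label; apply/eq_patternP => t.
by rewrite mem_sub_ball => tn; rewrite (label_good _ gu).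
Qed.
End Model.

Lemma finite_models (e : R) : (0 < e)%R ->
  exists (N : nat) (y : 'I_N.+1 -> fullshift F A),
    (forall g, exists rho : 'S_N.+1,
       forall u, shift_act F A g (y u) = y (rho u)) /\
    forall D, local D ->
      (`|freq R y (restrict_along (submonoid_incl Sigma) A @^-1` D)
         - mass mu D| <= e)%R.
Proof.
move=> e0; pose K := #|{: Q * Q}|; pose G := good_bound (letter d) K n.
(* [L] bounds, whatever the number of vertices, the error in a count: one unit
   per pattern for the rounding of the labels, plus the vertices not good. *)
pose L : R := (#|{: Q}| + G)%:R%R.
pose N := Num.truncn (L / e)%R.
pose v p := mass mu (pattern @^-1` [set p]).
have [C [vC CP]] :=
  rounded_labels N.+1 (fun p => mass_ge0 mu (pattern @^-1` [set p])) mass_patterns.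
have [s sP] : {s : letter d -> 'S_N.+1 & forall x, lettered x ->
    (#|[pred u | ~~ compatible x (tnth C u) (tnth C (s x u))]| <= K)%N}.
  apply: (@choice _ _ (fun x (s : 'S_N.+1) => lettered x ->
    (#|[pred u | ~~ compatible x (tnth C u) (tnth C (s u))]| <= K)%N)) => x.
  have [Sx|nSx] := pselect (lettered x); last by exists 1.
  by have [s sP] := edge_matching Sx vC; exists s.
pose y := model_point C s.
exists N, y; split => [g|D Dn].
  have actI : injective (word_act (letter_act s) g).
    by apply: can_inj; apply: word_actK; exact: letter_actK.
  by exists (perm actI) => u; rewrite permE /y shift_model_point.
pose P p := `[< exists2 x, pattern x = p & D x >].
have DP x : D x <-> P (pattern x).
  by split=> [Dx|/asboolP[z zx]]; [apply/asboolP; exists x|exact: Dn].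
have massD : mass mu D = (\sum_(p | P p) v p)%R.
  rewrite -(mass_sum mu P (fun p : Q => measurable_pattern p)).
  by congr (mass mu _); apply/seteqP; split=> x /DP.
pose E := restrict_along (submonoid_incl Sigma) A @^-1` D.
have freqC : (`|\sum_u \1_E (y u) - (count P C)%:R| <= G%:R :> R)%R.
  have -> : count P C = (\sum_(u < N.+1) P (tnth C u))%N.
    by rewrite -sum1_count big_tuple big_mkcond.
  rewrite natr_sum -sumrB (le_trans (ler_norm_sum _ _ _))//.
  apply: (@le_trans _ _ (\sum_u (~~ good (letter_act s) (bad C s) n u)%:R)%R).
    apply: ler_sum => u _.
    have [gu|_] /= := boolP (good (letter_act s) (bad C s) n u).
      rewrite indicE (_ : (y u \in E) = P (tnth C u)) ?subrr ?normr0//.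
      rewrite -(restrict_good gu); apply/idP/idP.
        by rewrite inE => /DP.
      by move=> /DP; rewrite inE.
    rewrite indicE; case: (_ \in _); case: (P _);
      by rewrite ?subrr ?subr0 ?sub0r ?normrN ?normr0 ?normr1.
  rewrite -natr_sum ler_nat.
  have -> : (\sum_u (~~ good (letter_act s) (bad C s) n u) =
      #|[pred u | ~~ good (letter_act s) (bad C s) n u]|)%N.
    rewrite -sum1_card [RHS]big_mkcond; apply: eq_bigr => u _.
    by rewrite inE; case: (good _ _ _ _).
  apply: card_not_good => x; last exact: (card_bad sP).
  exact: can_inj (letter_actK s x).
have freqD : (`|\sum_u \1_E (y u) - N.+1%:R * mass mu D| <= L)%R.
  rewrite (le_trans (ler_distD (count P C)%:R%R _ _))//.
  by rewrite /L natrD [X in (_ <= X)%R]addrC lerD// massD; exact: CP.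
have N0 : (0 < N.+1%:R :> R)%R by rewrite ltr0n.
have -> : (freq R y E - mass mu D =
    N.+1%:R^-1 * (\sum_u \1_E (y u) - N.+1%:R * mass mu D))%R.
  by rewrite /freq mulrBr mulKf// gt_eqF.
rewrite normrM gtr0_norm ?invr_gt0// ler_pdivrMl// (le_trans freqD)//.
by rewrite -ler_pdivrMr// ltW// truncnS_gt.
Qed.
End FiniteModels.

(** * Density of periodic measures and extension to the free group *)

Lemma ultra_bounded_cvg (R : realType) (U : set_system nat) (u : nat -> R) :
  UltraFilter U -> (forall k, 0 <= u k <= 1)%R ->
  exists2 l : R, (0 <= l)%R & u @ U --> l.
Proof.
move=> UU u01.
have cI : compact (`[0%R, 1%R]%classic : set R) by exact: segment_compact.
have UuP : UltraFilter (u @ U).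
  split; first exact: fmap_proper_filter.
  move=> G PG uG; apply/seteqP; split=> // D GD; rewrite /fmap /=.
  have [//|UnD] := in_ultra_setVsetC (u @^-1` D) UU.
  have /uG GnD : (u @ U) (~` D) by [].
  by have [z []] := filter_ex (filterI GD GnD).
move: cI; rewrite compact_ultra => /(_ _ UuP) [].
  by rewrite /fmap /=; apply: filterS filterT => k _ /=; rewrite in_itv /= u01.
by move=> l [/=]; rewrite in_itv /= => /andP[l0 _] ul; exists l.
Qed.

Lemma borel_map_unique (R : realType) (A : alphabetType) (T T' : choiceType)
    (B' : nat -> seq T') (nu : prob R (fullshift T A))
    (nu' : prob R (fullshift T' A)) (f : fullshift T A -> fullshift T' A) :
  exhaustion B' ->
  measurable_fun setT (f : borel _ -> borel _) ->
  (forall n D, local B' n D -> nu (f @^-1` D) = nu' D) ->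
  forall D : set (borel (fullshift T' A)), measurable D ->
    nu (f @^-1` D) = nu' D.
Proof.
move=> exB' mf H D mD; apply/esym.
pose pf :=
  measure_function_pushforward__canonical__measure_function_Measure nu mf.
apply: (borel_measure_unique (mu := nu') (nu := pf) exB') => //.
  by rewrite (le_lt_trans (probability_le1 _ _))// ltry.
by move=> n E /H /esym.
Qed.

Section Main.
Variables (R : realType) (d : nat) (Sigma : set (free_group d)).
Hypothesis SigmaP : Sigma `<=` [set fgen i | i in [set: 'I_d]] `|`
             [set (fgen i)^-1 | i in [set: 'I_d]].
Local Notation S := (submonoid Sigma).
Local Notation F := (free_group d).
Local Notation e k := (k.+1%:R^-1 : R)%R.

Let e_gt0 k : (0 < e k)%R. Proof. by rewrite invr_gt0. Qed.

Let exS : exhaustion (sub_ball Sigma).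
Proof. exact: sub_ball_exhaustion. Qed.

Let exF : exhaustion (@word_ball d).
Proof. exact: word_ball_exhaustion. Qed.

Lemma cvg_local (A : alphabetType) (mu : prob R (fullshift S A))
    (phi : nat -> set (fullshift S A) -> R) :
  (forall k D, local (sub_ball Sigma) k D -> (`|phi k D - mass mu D| <= e k)%R) ->
  forall n D, local (sub_ball Sigma) n D -> phi k D @[k --> \oo] --> mass mu D.
Proof.
move=> phiP n D Dn; apply/cvgrPdist_le => r r0.
have : e k @[k --> \oo] --> (0 : R)%R by exact: cvg_harmonic.
move=> /cvgrPdist_le/(_ _ r0) er; near=> k.
rewrite distrC; apply: le_trans (phiP k D _) _.
  by apply: (local_le exS) Dn; near: k; exact: nbhs_infty_ge.
suff : (`|0 - e k| <= r)%R by rewrite sub0r normrN ger0_norm// invr_ge0.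
by near: k.
Unshelve. all: by end_near. Qed.

Lemma submonoid_PA : has_PA R S.
Proof.
move=> A mu mu_inv.
have nuP k : exists nu : prob R (fullshift S A),
    periodic_measures R (shift_act S A) nu /\
    forall D, local (sub_ball Sigma) k D -> (`|mass nu D - mass mu D| <= e k)%R.
  have [N [y [yP yD]]] := finite_models SigmaP mu_inv k (e_gt0 k).
  pose z u := restrict_along (submonoid_incl Sigma) A (y u).
  have [nu nuE] := empirical_prob R z.
  exists nu; split; last by move=> D Dk; rewrite /mass nuE; exact: yD.
  split; last exact: finite_support_freq nuE.
  move=> a D _; rewrite !nuE; congr (_%:E).
  have [rho yr] := yP (\val a); apply: (@freq_perm _ _ _ _ _ rho) => u.
  by rewrite /z -yr.
have [nu nu_P] := choice nuP.
have cv : nu @ \oo --> mu.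
  by apply: (cvg_prob exS); apply: cvg_local => k; have [] := nu_P k.
move=> U /cv [k _ /(_ k (leqnn k)) Uk].
by exists (nu k); split=> //; have [] := nu_P k.
Qed.

Section Extension.
Variables (A : alphabetType) (mu : prob R (fullshift S A)).
Hypothesis mu_inv : invariant_measures R (shift_act S A) mu.
Local Notation Y := (fullshift F A).
Local Notation restrict := (restrict_along (submonoid_incl Sigma) A).

(** Along an ultrafilter the frequencies of every subset converge, so additivity
    and invariance, which hold exactly in each model, pass to the limit for all
    subsets at once; the agreement with [mu], approximate in each model, becomes
    exact since the ultrafilter refines the neighbourhoods of infinity. *)
Lemma invariant_mean : exists m : set Y -> R,
  [/\ forall D, (0 <= m D)%R, m setT = 1%R,
      forall D E, D `&` E = set0 -> m (D `|` E) = (m D + m E)%R,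
      forall g D, m (shift_act F A g @^-1` D) = m D &
      forall n D, local (sub_ball Sigma) n D -> m (restrict @^-1` D) = mass mu D].
Proof.
have phiP k : exists phi : set Y -> R,
  [/\ forall D, (0 <= phi D <= 1)%R, phi setT = 1%R,
      forall D E, D `&` E = set0 -> phi (D `|` E) = (phi D + phi E)%R,
      forall g D, phi (shift_act F A g @^-1` D) = phi D &
      forall D, local (sub_ball Sigma) k D ->
        (`|phi (restrict @^-1` D) - mass mu D| <= e k)%R].
  have [N [y [yP yD]]] := finite_models SigmaP mu_inv k (e_gt0 k).
  exists (freq R y); split=> //.
  - by move=> D; rewrite freq_ge0 freq_le1.
  - exact: freqT.
  - exact: freqU.
  - by move=> g D; have [rho yr] := yP g; exact: freq_perm yr.
have [phi /all_and5[phi01 phiT phiU phi_inv phi_mu]] := choice phiP.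
have [U [UU ooU]] := @ultraFilterLemma nat \oo _.
have mP D : exists l : R, (0 <= l)%R /\ phi k D @[k --> U] --> l.
  by have [//|l] := @ultra_bounded_cvg R U (phi ^~ D) UU; exists l.
have [m mP'] := choice mP; have m0 D := (mP' D).1; have cm D := (mP' D).2.
have UP : ProperFilter U by exact: ultra_proper.
have lim_eq (u : nat -> R) (l l' : R) : u @ U --> l -> u @ U --> l' -> l = l'.
  move=> ul ul'.
  exact: (@norm_cvg_unique R R (u @ U) (fmap_proper_filter u UP) l l').
exists m; split=> //.
- apply: lim_eq (cm setT) _.
  by rewrite (_ : phi ^~ setT = cst 1%R); [exact: cvg_cst|exact/funext].
- move=> D E DE; apply: lim_eq (cm _) _.
  rewrite (_ : phi ^~ _ = (fun k => phi k D + phi k E)%R); last first.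
    by apply/funext => k; exact: phiU.
  by apply: cvgD.
- move=> g D; apply: lim_eq (cm _) _.
  by rewrite (_ : phi ^~ _ = phi ^~ D)//; apply/funext => k; exact: phi_inv.
- move=> n D Dn; apply: lim_eq (cm _) _; apply: cvg_trans.
    by apply: (@cvg_app _ _ _ _ (phi ^~ (restrict @^-1` D))); exact: ooU.
  exact: (cvg_local (phi := fun k D => phi k (restrict @^-1` D)) phi_mu Dn).
Qed.

Lemma invariant_extension : exists2 nu : prob R Y,
  invariant_measures R (shift_act F A) nu &
  forall D : set (borel (fullshift S A)), measurable D ->
    nu (restrict @^-1` D) = mu D.
Proof.
have [m [m0 mT mU m_inv m_mu]] := invariant_mean.
have [||nu nuE] :=
  @clopen_content_extension R Y m _ m0 mT (fun D E _ _ => @mU D E).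
- exact: compact_fullshift.
- move=> U oU; have /(borel_windowed exF) : measurable (U : set (borel Y)).
    exact: sub_sigma_algebra.
  apply: smallest_sub; first exact: smallest_sigma_algebra.
  by move=> D [n Dn]; apply: sub_sigma_algebra; exact: clopen_local Dn.
exists nu.
  move=> g; apply: (borel_map_unique (nu := nu) (nu' := nu)
    (f := shift_act F A g) exF).
    exact: (@measurable_reindex _ _ A _ _ exF exF (fun h => h * g)).
  move=> n D Dn; have [k Dk] :=
    @windowed_reindex _ _ A _ _ exF (fun h => h * g) D (ex_intro _ n Dn).
  by rewrite (nuE _ (clopen_local Dn)) (nuE _ (clopen_local Dk)) m_inv.
apply: (borel_map_unique (nu := nu) (nu' := mu) (f := restrict) exS).
  exact: (@measurable_reindex _ _ A _ _ exF exS (submonoid_incl Sigma)).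
move=> n D Dn; have [k Dk] :=
  @windowed_reindex _ _ A _ _ exF (submonoid_incl Sigma) D (ex_intro _ n Dn).
rewrite (nuE _ (clopen_local Dk)) (m_mu n)// -massE//.
exact: measurable_local Dn.
Qed.
End Extension.
End Main.

Theorem theoremD (R : realType) (d : nat) (Sigma : set (free_group d)) :
  (1 <= d)%N ->
  Sigma `<=` [set fgen i | i in [set: 'I_d]] `|`
             [set (fgen i)^-1 | i in [set: 'I_d]] ->
  has_PA R (submonoid Sigma) /\
  (is_free_Sgroup (submonoid_incl Sigma) <->
     forall i : 'I_d, Sigma (fgen i) \/ Sigma (fgen i)^-1) /\
  (is_free_Sgroup (submonoid_incl Sigma) ->
     forall A : alphabetType,
       ext_measures R (submonoid_incl Sigma) A =
       invariant_measures R (shift_act (submonoid Sigma) A)).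
Proof.
move=> _ SigmaP; split; first exact: submonoid_PA.
split; first by split=> [[]|] *; [exact: Sgroup_letters|exact: letters_free].
move=> _ A; apply/seteqP; split=> [mu []//|mu mu_inv]; split=> //.
exact: invariant_extension.
Qed.
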